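(* The tempered incomplete gamma (TInG) subordinator $\{S_{\alpha,\theta}(t)\}_{t\ge0}$, with parameters $\alpha$ and $\theta>0$, has the long-range dependence (LRD) property.
   Context: The lower incomplete gamma function is $\gamma(\alpha;\eta)=\int_0^\eta e^{-y}y^{\alpha-1}\,dy$. The tempered incomplete gamma (TInG) subordinator $\{S_{\alpha,\theta}(t)\}_{t\ge0}$, $0<\alpha\le1$, $\theta>0$, is the non-decreasing Lévy process with $\mathbb{E}[e^{-\eta S_{\alpha,\theta}(t)}]=\exp\left(-t\alpha\left(\gamma(\alpha;\eta+\theta)-\gamma(\alpha;\theta)\right)\right)$, $\eta>0$. Long-range dependence: let $0<s<t$ with $s$ fixed, and suppose the correlation function of a stochastic process $\{X(t)\}_{t\ge0}$ satisfies $$\lim_{t\to\infty}\frac{\mathrm{Corr}[X(s),X(t)]}{t^{-d}}=c(s)$$ for some $c(s)>0$ and $d>0$. The process has the long-range dependence (LRD) property if $d\in(0,1)$ (and the short-range dependence property if $d\in(1,2)$). *)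

(* Defs.v *)
From mathcomp Require Import all_boot all_order all_algebra.
From mathcomp Require Import all_classical all_reals all_analysis.
From mathcomp Require Import measurable_realfun.

Set Implicit Arguments.
Unset Strict Implicit.
Unset Printing Implicit Defensive.

Import Order.TTheory GRing.Theory Num.Theory.
Import numFieldNormedType.Exports.

Local Open Scope classical_set_scope.
Local Open Scope ring_scope.

Definition lower_incomplete_gamma (R : realType) (alpha eta : R) : R :=
  \int[lebesgue_measure]_(y in `[0, eta]) (expR (- y) * y `^ (alpha - 1)).

Definition mutually_independent d (T : measurableType d) (R : realType)
    (P : probability T R) (n : nat) (Y : 'I_n -> {RV P >-> R}) : Prop :=
  forall B : 'I_n -> set R, (forall i, measurable (B i)) ->
    P (\bigcap_(i in [set: 'I_n]) (Y i @^-1` B i)) =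
    (\prod_(i < n) P (Y i @^-1` B i))%E.

(* In all that follows a process is indexed by the whole of [R], but only its
   values at times [t >= 0] are ever constrained or used. *)

(* Every finite sequence 0 <= t_0 < ... < t_n is the beginning of some strictly
   increasing [t : nat -> R]. *)
Definition independent_increments d (T : measurableType d) (R : realType)
    (P : probability T R) (X : R -> {RV P >-> R}) : Prop :=
  forall (n : nat) (t : nat -> R), 0 <= t 0%N -> (forall i, t i < t i.+1) ->
    mutually_independent (fun i : 'I_n => X (t i.+1) \- X (t i) : {RV P >-> R}).

(* Laws are compared on measurable sets only: the value of [P] on a
   non-measurable set is meaningless. *)
Definition stationary_increments d (T : measurableType d) (R : realType)
    (P : probability T R) (X : R -> {RV P >-> R}) : Prop :=
  forall s t : R, 0 <= s -> s <= t ->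
    forall B : set R, measurable B ->
      distribution P (X t \- X s : {RV P >-> R}) B =
      distribution P (X (t - s)) B.

Definition stochastically_continuous d (T : measurableType d) (R : realType)
    (P : probability T R) (X : R -> {RV P >-> R}) : Prop :=
  forall t eps : R, 0 <= t -> 0 < eps ->
    P [set w | eps < `|X u w - X t w|]
      @[u --> within [set u | 0 <= u] (nbhs t)] --> 0%E.

(* No path regularity is required: a process as below always has a càdlàg
   modification. *)
Record Levy_process d (T : measurableType d) (R : realType)
    (P : probability T R) (X : R -> {RV P >-> R}) : Prop := {
  Levy_start : {ae P, forall w, X 0 w = 0} ;
  Levy_independent : independent_increments X ;
  Levy_stationary : stationary_increments X ;
  Levy_continuous : stochastically_continuous X
}.

Record subordinator d (T : measurableType d) (R : realType)
    (P : probability T R) (X : R -> {RV P >-> R}) : Prop := {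
  subordinator_Levy : Levy_process X ;
  subordinator_nondecreasing :
    {ae P, forall w, forall s t : R, 0 <= s -> s <= t -> X s w <= X t w}
}.

Record TInG_subordinator d (T : measurableType d) (R : realType)
    (P : probability T R) (alpha theta : R) (S : R -> {RV P >-> R}) : Prop := {
  TInG_subordinator_of : subordinator S ;
  TInG_Laplace : forall t eta : R, 0 <= t -> 0 < eta ->
    ('E_P[fun w => expR (- (eta * S t w))] =
     (expR (- (t * alpha * (lower_incomplete_gamma alpha (eta + theta)
                            - lower_incomplete_gamma alpha theta))))%:E)%E
}.

(* When [X] or [Y] has infinite or zero variance the denominator is 0, and so
   is the quotient. *)
Definition correlation d (T : measurableType d) (R : realType)
    (P : probability T R) (X Y : {RV P >-> R}) : R :=
  fine (covariance P X Y) /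
  (Num.sqrt (fine ('V_P[X])%E) * Num.sqrt (fine ('V_P[Y])%E)).

Definition correlation_decay d (T : measurableType d) (R : realType)
    (P : probability T R) (X : R -> {RV P >-> R}) (delta : R) : Prop :=
  exists c : R -> R, forall s : R, 0 < s ->
    0 < c s /\
    correlation (X s) (X t) / t `^ (- delta) @[t --> +oo] --> c s.

Definition long_range_dependent d (T : measurableType d) (R : realType)
    (P : probability T R) (X : R -> {RV P >-> R}) : Prop :=
  exists delta : R, 0 < delta /\ delta < 1 /\ correlation_decay X delta.

(* Main.v *)
(* A nonnegative X has first and second moments equal to the monotone limits, as
   h -> 0+, of the expectations of (1 - e^{-hX})/h and of its square, which are
   difference quotients of the Laplace transform.  As the Laplace exponent
   t alpha (gamma(alpha; eta + theta) - gamma(alpha; theta)) is twice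
   differentiable at eta = 0, this gives Var S(t) = v t for every t >= 0, with
   v = alpha e^{-theta} (theta^(alpha-1) + (1 - alpha) theta^(alpha-2)) > 0.
   Stationarity gives Var(S(t) - S(s)) = v (t - s), so by polarization
   Cov(S(s), S(t)) = v s and Corr(S(s), S(t)) = sqrt(s/t): the exponent is
   1/2, with c(s) = sqrt s. *)
Require Import Defs.
From mathcomp Require Import all_boot all_order all_algebra.
From mathcomp Require Import all_classical all_reals all_analysis.
From mathcomp Require Import measurable_realfun ring lra.

Import Order.TTheory GRing.Theory Num.Theory.
Import numFieldNormedType.Exports.

Local Open Scope classical_set_scope.
Local Open Scope ring_scope.

(** * Expectations of Laplace difference quotients *)

Section laplace.
Context {R : realType} d (T : measurableType d) (P : probability T R).

(** Monotone convergence, with sign and monotonicity of [phi] known only on the half-line. Replacing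
    [X] by its positive part makes them hold at every point and changes no integral. *)
Lemma cvg_integral_ae_ge0 (X : T -> R) (phi : nat -> R -> R) (psi : R -> R) :
  measurable_fun setT X -> {ae P, forall w, 0 <= X w} ->
  (forall n, measurable_fun setT (phi n)) -> measurable_fun setT psi ->
  (forall n x, 0 <= x -> 0 <= phi n x) ->
  (forall x, 0 <= x -> {homo phi ^~ x : m n / (m <= n)%N >-> m <= n}) ->
  (forall x, 0 <= x -> phi n x @[n --> \oo] --> psi x) ->
  (\int[P]_w (phi n (X w))%:E @[n --> \oo] --> \int[P]_w (psi (X w))%:E)%E.
Proof.
move=> mX X0 mphi mpsi phi0 nd_phi cvg_phi.
pose Y w := Num.max (X w) 0.
have Y0 w : 0 <= Y w by rewrite le_max lexx orbT.
have mY : measurable_fun setT Y by exact: measurable_funrpos.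
have XY (F : R -> R) : measurable_fun setT F ->
    (\int[P]_w (F (X w))%:E = \int[P]_w (F (Y w))%:E)%E.
  move=> mF; apply: ae_eq_integral => //.
  - by apply/measurable_EFinP; exact: measurableT_comp.
  - by apply/measurable_EFinP; exact: measurableT_comp.
  - by apply: filterS X0 => w Xw _; rewrite /Y max_l.
rewrite XY//; under eq_fun do rewrite XY//.
have cvgY w : (phi n (Y w))%:E @[n --> \oo] --> (psi (Y w))%:E.
  by apply: cvg_EFin; [exact: nearW|exact: cvg_phi].
under eq_integral => w _ do rewrite -(cvg_lim _ (cvgY w))//.
apply: cvg_monotone_convergence => //.
- by move=> n; apply/measurable_EFinP; exact: measurableT_comp.
- by move=> n w _; rewrite lee_fin phi0.
- by move=> w _ m n mn; rewrite lee_fin nd_phi.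
Qed.


(** The integrand is positive, so a real expectation already means integrability; linearity of the
    expectation then applies below. *)
Lemma laplace_integrable (X : T -> R) (G : R) (h : R) : measurable_fun setT X ->
  ('E_P[fun w => expR (- (h * X w))])%E = G%:E ->
  (fun w => expR (- (h * X w))) \in Lfun P 1.
Proof.
move=> mX; rewrite unlock => EG; apply/Lfun1_integrable/integrableP; split.
  apply/measurable_EFinP; apply: measurableT_comp => //.
  by apply: measurableT_comp => //; exact: measurable_funM.
under eq_integral => w _ do rewrite /= ger0_norm ?expR_ge0//.
by rewrite EG ltry.
Qed.

Definition expquot (h x : R) : R := (1 - expR (- (h * x))) / h.

Lemma expectation_expquot (X : T -> R) (G h : R) : measurable_fun setT X ->
  ('E_P[fun w => expR (- (h * X w))])%E = G%:E ->
  ('E_P[expquot h \o X])%E = ((1 - G) / h)%:E.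
Proof.
move=> mX EG; have L1 := laplace_integrable _ _ _ mX EG.
rewrite (_ : _ \o _ =
    h^-1 \o* (cst 1 \- (fun w => expR (- (h * X w)))))//.
rewrite expectationZl ?rpredB ?Lfun_cst// expectationB ?Lfun_cst//.
by rewrite expectation_cst EG -EFinB -EFinM mulrC.
Qed.

Lemma expectation_expquot_sqr (X : T -> R) (G G2 h : R) :
  measurable_fun setT X ->
  ('E_P[fun w => expR (- (h * X w))])%E = G%:E ->
  ('E_P[fun w => expR (- ((h + h) * X w))])%E = G2%:E ->
  ('E_P[fun w => (expquot h (X w) ^+ 2)%R])%E = ((1 - 2 * G + G2) / h ^+ 2)%:E.
Proof.
move=> mX EG EG2; have L1 := laplace_integrable _ _ _ mX EG.
have L2 := laplace_integrable _ _ _ mX EG2.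
rewrite (_ : (fun w => _) =
    (h ^+ 2)^-1 \o* ((cst 1 \- 2 \o* (fun w => expR (- (h * X w))))
      \+ (fun w => expR (- ((h + h) * X w))))); last first.
  apply/funext => w /=; rewrite /expquot (mulrDl h) (opprD (h * X w)) expRD.
  by rewrite exprMn exprVn; congr (_ * _); ring.
have L3 : (2 \o* (fun w => expR (- (h * X w)))) \in Lfun P 1.
  exact: Lfun_scale.
have L4 : (cst 1 \- 2 \o* (fun w => expR (- (h * X w)))) \in Lfun P 1.
  by rewrite rpredB ?Lfun_cst.
rewrite expectationZl; last by rewrite rpredD.
rewrite expectationD// expectationB ?Lfun_cst//.
rewrite expectationZl// expectation_cst EG EG2.
by rewrite -EFinM mulrC.
Qed.

End laplace.

(** * First and second difference quotients at 0 from the right *)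

(* (1 - e^{-2hx})/(2h) is (1 - e^{-hx})/h times (1 + e^{-hx})/2 <= 1. *)
Lemma expquot_half {R : realType} (h x : R) : 0 < h -> 0 <= x ->
  expquot (h + h) x <= expquot h x.
Proof.
move=> h0 x0; rewrite /expquot.
have e1 : expR (- (h * x)) <= 1.
  by rewrite -expR0 ler_expR oppr_le0 mulr_ge0// ltW.
rewrite (mulrDl h) (opprD (h * x)) expRD ler_pdivrMr ?addr_gt0//.
have -> : (1 - expR (- (h * x))) / h * (h + h) = (1 - expR (- (h * x))) * 2.
  by field; rewrite gt_eqF.
have := expR_gt0 (- (h * x)); nra.
Qed.

Lemma expquot_ge0 {R : realType} (h x : R) :
  0 < h -> 0 <= x -> 0 <= expquot h x.
Proof.
move=> h0 x0; rewrite divr_ge0 ?(ltW h0)// subr_ge0 -expR0 ler_expR.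
by rewrite oppr_le0 mulr_ge0// ltW.
Qed.

Lemma cvg_right_diffquot {R : realType} (f : R -> R) (a l : R) :
  is_derive a 1 f l -> (f (a + h) - f a) / h @[h --> 0^'+] --> l.
Proof.
move=> [df fl].
have : h^-1 *: (f (h *: 1 + a) - f a) @[h --> 0^'] --> l.
  by rewrite -fl; exact: df.
move=> /cvg_dnbhs_at_right; apply: cvg_trans; apply: near_eq_cvg.
by near=> h; rewrite /= [_ *: 1]mulr1 (addrC h) mulrC.
Unshelve. all: by end_near. Qed.

Lemma expquot_cvg {R : realType} (x : R) : expquot h x @[h --> 0^'+] --> x.
Proof.
have D : is_derive (0 : R) 1 (fun h => 1 - expR (- (h * x))) x.
  apply: is_derive_eq.
  by rewrite mul0r oppr0 expR0 scale0r [x%:A]mulr1; ring.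
have := cvg_right_diffquot _ _ _ D; apply: cvg_trans; apply: near_eq_cvg.
by near=> h; rewrite /expquot add0r mul0r oppr0 expR0 subrr subr0.
Unshelve. all: by end_near. Qed.

(** One use of L'Hôpital's rule leaves (G'(2h) - G'(h))/h. Since [G'] is differentiable only at 0,
    this limit is read as a derivative there: 2l - l = l. *)
Lemma cvg_second_diffquot {R : realType} (G G' : R -> R) (b l : R) : 0 < b ->
  (forall h : R, `|h| < b -> is_derive h 1 G (G' h)) ->
  is_derive (0 : R) 1 G' l ->
  (G 0 - 2 * G h + G (h + h)) / h ^+ 2 @[h --> 0^'+] --> l.
Proof.
move=> b0 dG dG'.
have dadd (h : R) : is_derive h 1 (fun x : R => x + x) (2 : R).
  by apply: is_derive_eq.
pose f h := G 0 - 2 * G h + G (h + h).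
have df (h : R) : `|h + h| < b -> is_derive h 1 f (2 * (G' (h + h) - G' h)).
  move=> hb.
  have d1 : is_derive h 1 (fun x => G (x + x)) (G' (h + h) * 2).
    exact: (@is_derive1_comp _ G (fun x => x + x) h _ _ (dG _ hb) (dadd h)).
  have d2 : is_derive h 1 G (G' h).
    by apply: dG; apply: le_lt_trans hb; rewrite -mulr2n normrMn mulr2n lerDl.
  by apply: is_derive_eq; rewrite /GRing.scale/=; ring.
have f0 : f 0 = 0 by rewrite /f addr0; ring.
(* On ]0, b/2[ both h and 2h stay within the radius where [G] is differentiable. *)
have b20 : 0 < b / 2 by rewrite divr_gt0.
have hb (h : R) : h \in `]0, b / 2[ -> `|h + h| < b.
  rewrite in_itv/= => /andP[h0 hb]; rewrite ger0_norm; first lra.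
  by rewrite addr_ge0// ltW.
have cvg0 (g : R -> R) (g' : R) : is_derive (0 : R) 1 g g' ->
    g 0 = 0 -> g x @[x --> 0^'+] --> 0.
  move=> [D _] g0; rewrite -[X in _ --> X]g0; apply: cvg_at_right_filter.
  have /differentiable_continuous c : differentiable g (0 : R).
    exact/derivable1_diffP.
  exact: c.
apply: (@lhopital_at_right R f (fun h => 2 * (G' (h + h) - G' h))
    (fun h => h ^+ 2) (fun h => 2 * h) 0 (b / 2) l b20).
- by move=> h /hb; exact: df.
- by move=> h _; apply: is_derive_eq; rewrite /GRing.scale/=; ring.
- by apply: cvg0 f0; apply: df; rewrite addr0 normr0.
- apply: (cvg0 _ 0); last by rewrite expr0n.
  by apply: is_derive_eq; rewrite /GRing.scale/=; ring.
- by move=> h; rewrite in_itv/= => /andP[h0 _]; rewrite mulf_neq0 ?gt_eqF.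
have d1 : is_derive (0 : R) 1 (fun x => G' (x + x)) (l * 2).
  apply: (@is_derive1_comp _ G' (fun x => x + x) 0 _ _ _ (dadd 0)).
  by rewrite addr0.
have d2 : is_derive (0 : R) 1 (fun h => G' (h + h) - G' h) l.
  by apply: is_derive_eq; ring.
have := cvg_right_diffquot _ _ _ d2; apply: cvg_trans; apply: near_eq_cvg.
near=> h.
have h0 : h != 0 by rewrite gt_eqF.
by rewrite !add0r subrr subr0; field.
Unshelve. all: by end_near. Qed.

(** * Moments of a nonnegative variable from its Laplace transform *)

Section laplace_moments.
Context {R : realType} d (T : measurableType d) (P : probability T R).
Variables (X : {RV P >-> R}) (G G' : R -> R) (b l : R).
Hypothesis X0 : {ae P, forall w, 0 <= X w}.
Hypothesis EG : forall h, 0 < h ->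
  ('E_P[fun w => expR (- (h * X w))])%E = (G h)%:E.
Hypotheses (b0 : 0 < b) (G0 : G 0 = 1).
Hypothesis dG : forall h : R, `|h| < b -> is_derive h 1 G (G' h).
Hypothesis dG' : is_derive (0 : R) 1 G' l.

(** Dyadic steps, because [expquot_half] compares h only with 2h; this is enough for monotonicity in
    n. *)
Let half n : R := 2^-1 ^+ n.

Let half_gt0 n : 0 < half n. Proof. by rewrite exprn_gt0// invr_gt0. Qed.

Let halfD n : half n = half n.+1 + half n.+1.
Proof. by rewrite /half exprS; field. Qed.

Let cvg_half (f : R -> R) (y : R) :
  f h @[h --> 0^'+] --> y -> f (half n) @[n --> \oo] --> y.
Proof.
move=> /cvg_at_rightP; apply; split => //.
by apply: cvg_expr; rewrite ger0_norm ?invf_lt1 ?ltr1n.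
Qed.

Let expquot_nd x : 0 <= x ->
  {homo (fun n => expquot (half n) x) : m n / (m <= n)%N >-> m <= n}.
Proof.
move=> x0; apply/nondecreasing_seqP => n.
by rewrite (halfD n); exact: expquot_half.
Qed.

Let measurable_expquot h : measurable_fun setT (@expquot R h).
Proof.
apply: measurable_funM => //; apply: measurable_funB => //.
by apply: measurableT_comp => //; exact: measurableT_comp.
Qed.

Let measurable_X : measurable_fun setT X. Proof. by []. Qed.

Let cvg_diffquot1 : (1 - G h) / h @[h --> 0^'+] --> - G' 0.
Proof.
have dG0 : is_derive (0 : R) 1 G (G' 0) by apply: dG; rewrite normr0.
have := cvg_right_diffquot _ _ _ dG0; move=> /cvgN; apply: cvg_trans.
apply: near_eq_cvg; near=> h.
by rewrite fctE/= add0r G0 -mulNr opprB.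
Unshelve. all: by end_near. Qed.

(** One sequence has two limits: the expectation, by monotone convergence in the extended reals, and
    a derivative of [G]. Finiteness of the moment is thus a result, not an assumption. *)
Lemma laplace_expectation : 'E_P[X]%E = (- G' 0)%:E.
Proof.
have c1 : ('E_P[expquot (half n) \o X] @[n --> \oo] --> 'E_P[X])%E.
  rewrite unlock; apply: (cvg_integral_ae_ge0 _ _ P X
    (fun n => expquot (half n)) id) => //.
  - by move=> n x; exact: expquot_ge0.
  - by move=> x x0; apply: (cvg_half (expquot^~ x)); exact: expquot_cvg.
apply: (cvg_unique _ c1) => //.
have E n : ('E_P[expquot (half n) \o X])%E = ((1 - G (half n)) / half n)%:E.
  by apply: expectation_expquot => //; exact: EG.
rewrite (funext E).
apply: cvg_EFin; first exact: nearW.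
exact: (cvg_half (fun h => (1 - G h) / h)).
Qed.

Lemma laplace_second_moment : ('E_P[fun w => (X w ^+ 2)%R])%E = l%:E.
Proof.
have c1 : ('E_P[fun w => (expquot (half n) (X w) ^+ 2)%R] @[n --> \oo] -->
    'E_P[fun w => (X w ^+ 2)%R])%E.
  rewrite unlock; apply: (cvg_integral_ae_ge0 _ _ P X
    (fun n x => expquot (half n) x ^+ 2) (fun x => x ^+ 2)) => //.
  - by move=> n; exact: measurable_funX.
  - by move=> n x _; exact: sqr_ge0.
  - move=> x x0 m n mn; rewrite ler_sqr ?nnegrE ?expquot_ge0//.
    exact: expquot_nd.
  - move=> x x0; apply: (cvg_half (fun h => expquot h x ^+ 2)).
    by rewrite expr2; apply: cvgM; exact: expquot_cvg.
apply: (cvg_unique _ c1) => //.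
have half2 n : 0 < half n + half n by rewrite addr_gt0.
have E n : ('E_P[fun w => (expquot (half n) (X w) ^+ 2)%R])%E =
    ((G 0 - 2 * G (half n) + G (half n + half n)) / half n ^+ 2)%:E.
  by rewrite G0; apply: expectation_expquot_sqr => //; exact: EG.
rewrite (funext E).
apply: cvg_EFin; first exact: nearW.
exact: (cvg_half (fun h => (G 0 - 2 * G h + G (h + h)) / h ^+ 2)
  _ (cvg_second_diffquot _ _ _ _ b0 dG dG')).
Qed.

Lemma laplace_Lfun2 : (X : T -> R) \in Lfun P 2%:E.
Proof.
apply/andP; split; rewrite inE//=.
rewrite /finite_norm unlock; apply: poweR_lty.
have := laplace_second_moment; rewrite unlock => E2.
under eq_integral => w _ do
  rewrite abse_EFin poweR_EFin powR_mulrn// real_normK ?num_real//.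
by rewrite E2 ltry.
Qed.

Lemma laplace_variance : ('V_P[X])%E = (l - G' 0 ^+ 2)%:E.
Proof.
rewrite varianceE; last exact: laplace_Lfun2.
by rewrite laplace_expectation laplace_second_moment -EFin_expe -EFinB sqrrN.
Qed.

End laplace_moments.

(** * Differentiability of the lower incomplete gamma function *)

Section gamma_density.
Context {R : realType}.
Notation mu := (@lebesgue_measure R).

Lemma integral_powR_itv (alpha a b : R) : 0 < alpha -> 0 < a -> a < b ->
  (\int[mu]_(y in `[a, b]) (y `^ (alpha - 1))%:E =
    (b `^ alpha / alpha - a `^ alpha / alpha)%:E)%E.
Proof.
move=> alpha0 a0 ab.
pose F y := alpha^-1 * y `^ alpha.
have dF (y : R) : 0 < y -> is_derive y 1 F (y `^ (alpha - 1)).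
  move=> y0; have dp := is_derive1_powR alpha y0.
  by apply: is_derive_eq; rewrite /GRing.scale/=; field; rewrite gt_eqF.
have cF (y : R) : 0 < y -> {for y, continuous F}.
  move=> y0; have [D _] := dF y y0.
  by apply: differentiable_continuous; exact/derivable1_diffP.
have b0 := lt_trans a0 ab.
rewrite (@continuous_FTC2 _ (fun y => y `^ (alpha - 1)) F)//.
- by rewrite -EFinB /F; congr (_%:E); ring.
- apply: derivable_within_continuous => y; rewrite in_itv/= => /andP[ay _].
  by apply: ex_derive; apply: is_derive1_powR; exact: lt_le_trans ay.
- split.
  + move=> y; rewrite in_itv/= => /andP[ay _].
    by apply: ex_derive; apply: dF; exact: lt_trans ay.
  + exact/cvg_at_right_filter/cF.
  + exact/cvg_at_left_filter/cF.
- move=> y; rewrite in_itv/= => /andP[ay _].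
  by rewrite derive1E; have [_ ->] := dF y (lt_trans a0 ay).
Qed.

(** The integrand may blow up at 0. Exhausting ]0, b] by [b/(n+1), b] keeps the integrals below
    b^alpha / alpha. *)
Lemma integrable_powR_itv (alpha b : R) : 0 < alpha -> 0 < b ->
  mu.-integrable `[0, b] (EFin \o (fun y => y `^ (alpha - 1))).
Proof.
move=> alpha0 b0.
have mp : measurable_fun setT
    (EFin \o (fun y => y `^ (alpha - 1)) : R -> \bar R).
  by apply/measurable_EFinP; exact: measurable_powR.
apply/integrableP; split; first exact: measurable_funTS.
under eq_integral => y _ do rewrite /= ger0_norm ?powR_ge0//.
rewrite -integral_itv_obnd_cbnd; last exact: measurable_funTS.
pose F n := `[b / n.+1%:R, b]%classic.
have -> : `]0, b]%classic = \bigcup_n F n.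
  apply/seteqP; split => y /=.
    (* With n the integer part of b/y, n + 1 exceeds b/y, so b/(n+1) < y. *)
    rewrite in_itv/= => /andP[y0 yb]; exists (Num.truncn (b / y)) => //.
    rewrite /F/= in_itv/= yb andbT ler_pdivrMr ?ltr0n// -ler_pdivrMl//.
    by rewrite mulrC ltW// truncnS_gt.
  move=> [n _]; rewrite /F/= !in_itv/= => /andP[ny ->]; rewrite andbT.
  by apply: lt_le_trans ny; rewrite divr_gt0.
apply: (@le_lt_trans _ _ (b `^ alpha / alpha)%:E); last by rewrite ltry.
have cv : (\int[mu]_(y in F n) (y `^ (alpha - 1))%:E @[n --> \oo] -->
    \int[mu]_(y in \bigcup_n F n) (y `^ (alpha - 1))%:E)%E.
  apply: ge0_nondecreasing_set_cvg_integral => //.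
  - apply/nondecreasing_seqP => n; rewrite subsetEset; apply: subset_itvr.
    by rewrite bnd_simp ler_pM2l// lef_pV2 ?posrE ?ltr0n// ler_nat.
  - by move=> n; exact: measurable_itv.
  - by move=> n; exact: measurable_funTS.
  - by move=> n y _; rewrite lee_fin powR_ge0.
rewrite -(cvg_lim _ cv)//; apply: lime_le.
  by apply/cvg_ex; eexists; exact: cv.
(* For n = 0 the interval degenerates to {b}; n >= 1 gives b/(n+1) < b. *)
near=> n; rewrite integral_powR_itv ?divr_gt0//; last first.
  rewrite ltr_pdivrMr ?ltr0n// ltr_pMr// ltr1n ltnS.
  by near: n; exists 1%N.
by rewrite lee_fin gerBl// divr_ge0 ?powR_ge0// ltW.
Unshelve. all: by end_near. Qed.

Definition gamma_density (alpha y : R) : R := expR (- y) * y `^ (alpha - 1).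

Lemma integrable_gamma_density (alpha b : R) : 0 < alpha -> 0 < b ->
  mu.-integrable `[0, b] (EFin \o gamma_density alpha).
Proof.
move=> alpha0 b0.
have := integrable_powR_itv alpha b alpha0 b0; apply: le_integrable => //.
  apply/measurable_EFinP/measurable_funTS; apply: measurable_funM.
    exact: measurableT_comp.
  exact: measurable_powR.
move=> y; rewrite /= in_itv/= => /andP[y0 _].
rewrite lee_fin ger0_norm ?mulr_ge0 ?expR_ge0 ?powR_ge0//.
by rewrite ger0_norm ?powR_ge0// ler_piMl ?powR_ge0// -expR0 ler_expR oppr_le0.
Qed.

(** The outer minus sign leaves a bracket that is visibly positive for alpha <= 1 and y > 0. *)
Definition gamma_density' (alpha y : R) : R :=
  - (expR (- y) * (y `^ (alpha - 1) + (1 - alpha) * y `^ (alpha - 1 - 1))).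

Lemma is_derive_gamma_density (alpha y : R) : 0 < y ->
  is_derive y 1 (gamma_density alpha) (gamma_density' alpha y).
Proof.
move=> y0; have dp := is_derive1_powR (alpha - 1) y0.
by apply: is_derive_eq; rewrite /gamma_density' /GRing.scale/=; ring.
Qed.

Lemma is_derive_lower_incomplete_gamma (alpha x : R) : 0 < alpha -> 0 < x ->
  is_derive x 1 (lower_incomplete_gamma alpha) (gamma_density alpha x).
Proof.
move=> alpha0 x0.
(* Any right endpoint beyond x would do: it makes x interior to the interval of integration. *)
have xx1 : x < x + 1 by rewrite ltrDl.
have [|D E] := continuous_FTC1_closed xx1
  (integrable_gamma_density _ _ alpha0 (lt_trans x0 xx1)) x0.
  apply: differentiable_continuous; apply/derivable1_diffP.
  by apply: ex_derive; exact: is_derive_gamma_density.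
by split; [exact: D|rewrite -derive1E].
Qed.

End gamma_density.

(** * Variance, covariance and correlation of the TInG subordinator *)

Section TInG.
Context {R : realType} d (T : measurableType d) (P : probability T R).
Variables (alpha theta : R).
Hypotheses (alpha_gt0 : 0 < alpha) (theta_gt0 : 0 < theta).

(** Stated for a single variable so as to serve both the values of the process and its increments.
    Since G''(0) = -t alpha g'(theta) + G'(0)^2, with g the gamma density, the square cancels in the
    variance. *)
Lemma TInG_law_moments (X : {RV P >-> R}) (t : R) :
  {ae P, forall w, 0 <= X w} ->
  (forall h, 0 < h -> ('E_P[fun w => expR (- (h * X w))])%E =
    (expR (- (t * alpha * (lower_incomplete_gamma alpha (h + theta)
      - lower_incomplete_gamma alpha theta))))%:E) ->
  (X : T -> R) \in Lfun P 2%:E /\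
  ('V_P[X])%E = (t * (alpha * - gamma_density' alpha theta))%:E.
Proof.
move=> X0 EX.
pose G h := expR (- (t * alpha * (lower_incomplete_gamma alpha (h + theta)
      - lower_incomplete_gamma alpha theta))).
pose G' h := - (t * alpha * gamma_density alpha (h + theta)) * G h.
(* The radius is [theta]: it keeps h + theta in the open half-line where the gamma function is
   differentiable. *)
have htheta (h : R) : `|h| < theta -> 0 < h + theta.
  by rewrite ltr_norml => /andP[]; lra.
have dshift (h : R) : is_derive h 1 (fun x : R => x + theta) (1 : R).
  by apply: is_derive_eq; rewrite addr0.
have dG (h : R) : `|h| < theta -> is_derive h 1 G (G' h).
  move=> /htheta h0.
  have dg := @is_derive1_comp _ (lower_incomplete_gamma alpha)
    (fun x => x + theta) h _ _
    (is_derive_lower_incomplete_gamma _ _ alpha_gt0 h0) (dshift h).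
  have {}dg : is_derive h 1 (fun x => lower_incomplete_gamma alpha (x + theta))
    (gamma_density alpha (h + theta) * 1) by exact: dg.
  by apply: is_derive_eq; rewrite /G' /G /GRing.scale/=; ring.
have G0 : G 0 = 1 by rewrite /G add0r subrr mulr0 oppr0 expR0.
have dG' : is_derive (0 : R) 1 G'
    (- (t * alpha * gamma_density' alpha theta) + G' 0 ^+ 2).
  have zt : 0 < 0 + theta by rewrite add0r.
  have dg := @is_derive1_comp _ (gamma_density alpha) (fun x => x + theta)
    0 _ _ (is_derive_gamma_density alpha (0 + theta) zt) (dshift 0).
  have {}dg : is_derive (0 : R) 1 (fun x => gamma_density alpha (x + theta))
    (gamma_density' alpha (0 + theta) * 1) by exact: dg.
  have dG0 : is_derive (0 : R) 1 G (G' 0) by apply: dG; rewrite normr0.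
  by apply: is_derive_eq; rewrite /G' G0 add0r /GRing.scale/=; ring.
split; first exact: (laplace_Lfun2 _ _ _ _ _ _ _ _ X0 EX theta_gt0 G0 dG dG').
rewrite (laplace_variance _ _ _ _ _ _ _ _ X0 EX theta_gt0 G0 dG dG').
by congr (_%:E); ring.
Qed.

Variable S : R -> {RV P >-> R}.
Hypothesis S_TInG : TInG_subordinator alpha theta S.

Lemma TInG_increment_moments (s t : R) : 0 <= s -> s <= t ->
  S t \- S s \in Lfun P 2%:E /\
  ('V_P[(S t \- S s)%R])%E =
    ((t - s) * (alpha * - gamma_density' alpha theta))%:E.
Proof.
move=> s0 st.
have [[[_ _ S_stat _] S_nd] S_lap] := S_TInG.
apply: (TInG_law_moments (S t \- S s)).
  by apply: filterS S_nd => w /(_ _ _ s0 st); rewrite subr_ge0.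
move=> h h0; rewrite -S_lap ?subr_ge0// unlock.
(* Stationarity speaks of laws, so both expectations are rewritten as integrals of x |-> e^{-hx}
   against the distributions. *)
have mE : measurable_fun setT (fun x : R => (expR (- (h * x)))%:E).
  apply/measurable_EFinP; apply: measurableT_comp => //.
  by apply: measurableT_comp => //; exact: measurable_funM.
have E0 (x : R) : (0 <= (expR (- (h * x)))%:E)%E by rewrite lee_fin expR_ge0.
have := ge0_integral_distribution (S t \- S s : {RV P >-> R}) mE E0.
rewrite /comp => <-.
have := ge0_integral_distribution (S (t - s)) mE E0.
rewrite /comp => <-.
by apply: eq_measure_integral => B mB _; exact: S_stat.
Qed.

Lemma TInG_moments (t : R) : 0 <= t ->
  (S t : T -> R) \in Lfun P 2%:E /\
  ('V_P[S t])%E = (t * (alpha * - gamma_density' alpha theta))%:E.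
Proof.
move=> t0.
have [[[S_start _ _ _] S_nd] S_lap] := S_TInG.
apply: TInG_law_moments; last by move=> h h0; exact: S_lap.
by apply: filterS2 S_start S_nd => w S0 /(_ _ _ (lexx 0) t0); rewrite S0.
Qed.

(** Polarization: v(t - s) = vt + vs - 2 Cov, where v is the variance per unit time. *)
Lemma TInG_covariance (s t : R) : 0 <= s -> s <= t ->
  (covariance P (S s) (S t))%E =
    (s * (alpha * - gamma_density' alpha theta))%:E.
Proof.
move=> s0 st.
have [Ls Vs] := TInG_moments _ s0.
have [Lt Vt] := TInG_moments _ (le_trans s0 st).
have [_ Vst] := TInG_increment_moments _ _ s0 st.
have Pfin : P setT \is a fin_num by exact: fin_num_measure.
(* Finiteness allows the identity to be solved for the covariance in the reals. *)
have Cfin : (covariance P (S s) (S t))%E \is a fin_num.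
  by apply: covariance_fin_num; rewrite ?Lfun2_mul_Lfun1 ?(Lfun_subset12 Pfin).
have := varianceB Lt Ls; rewrite Vst Vs Vt covarianceC -(fineK Cfin).
by move=> /(congr1 fine) /= E; congr (_%:E); lra.
Qed.

Lemma TInG_correlation (s t : R) : alpha <= 1 -> 0 < s -> s <= t ->
  correlation (S s) (S t) = Num.sqrt s / Num.sqrt t.
Proof.
move=> alpha1 s0 st; have t0 := lt_le_trans s0 st.
(* Here alpha <= 1 gives the sign of the term with factor 1 - alpha. *)
have v0 : 0 < alpha * - gamma_density' alpha theta.
  rewrite mulr_gt0// /gamma_density' opprK mulr_gt0 ?expR_gt0//.
  by rewrite ltr_wpDr ?powR_gt0// mulr_ge0 ?powR_ge0// subr_ge0.
have [_ Vs] := TInG_moments _ (ltW s0).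
have [_ Vt] := TInG_moments _ (ltW t0).
rewrite /correlation TInG_covariance ?(ltW s0)// Vs Vt /=.
move: (alpha * _) v0 => v v0.
rewrite !sqrtrM ?(ltW s0) ?(ltW t0)//.
rewrite -{1}(sqr_sqrtr (ltW s0)) -{1}(sqr_sqrtr (ltW v0)).
have s1 : Num.sqrt s != 0 by rewrite gt_eqF// sqrtr_gt0.
have t1 : Num.sqrt t != 0 by rewrite gt_eqF// sqrtr_gt0.
have v1 : Num.sqrt v != 0 by rewrite gt_eqF// sqrtr_gt0.
by field; rewrite s1 t1 v1.
Qed.

End TInG.

Theorem theorem5p2 (R : realType) (d : measure_display) (T : measurableType d)
    (P : probability T R) (alpha theta : R) (S : R -> {RV P >-> R})
    (alpha_gt0 : 0 < alpha) (alpha_le1 : alpha <= 1) (theta_gt0 : 0 < theta)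
    (S_TInG : TInG_subordinator alpha theta S) :
  long_range_dependent S.
Proof.
exists 2^-1; rewrite invr_gt0 ltr0n; split => //; split.
  by rewrite invf_lt1 ?ltr1n.
exists Num.sqrt => s s0; rewrite sqrtr_gt0; split => //.
(* For t >= s the ratio equals sqrt s exactly, as t^(-1/2) = 1/sqrt t cancels the denominator. *)
apply: cvg_near_cst.
near=> t.
have st : s <= t by near: t; apply: nbhs_pinfty_ge; exact: num_real.
have t0 := lt_le_trans s0 st.
rewrite (TInG_correlation _ _ _ _ _ alpha_gt0 theta_gt0 _ S_TInG)//.
rewrite powRN powR12_sqrt ?(ltW t0)// invrK divfK//.
by rewrite gt_eqF// sqrtr_gt0.
Unshelve. all: by end_near. Qed.
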